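(* Let $r\in\mathbb{N}$. Every $r$-regular digraph $D$ satisfies $\mathrm{dtw}(D)\ge\left\lfloor\frac{r}{20}\right\rfloor$.
   Context: Digraphs are finite, have no loops and no parallel arcs (antiparallel arcs allowed). A digraph is $r$-regular if every vertex has out-degree and in-degree exactly $r$. Directed tree-width (Johnson, Robertson, Seymour, Thomas): for $X\subseteq V(D)$, a set $Z\subseteq V(D)\setminus X$ is $X$-normal if there is no directed walk in $D-X$ whose first and last vertices lie in $Z$ and which contains a vertex not in $Z$. An arborescence is a directed tree $R$ with a root $r_0$ such that every vertex of $R$ is reachable from $r_0$ by a directed path. An arboreal decomposition of $D$ is a triple $(R,(X_e)_{e\in A(R)},(W_t)_{t\in V(R)})$ where $R$ is an arborescence, the $W_t$ are nonempty, pairwise disjoint sets with union $V(D)$, each $X_e\subseteq V(D)$, and for every arc $e=(s,t)$ of $R$ the set $\bigcup\{W_u: u \text{ reachable from } t \text{ in } R\}$ is $X_e$-normal. Its width is $\max_{t\in V(R)}\left|W_t\cup\bigcup_{e\text{ incident with }t}X_e\right|-1$. The directed tree-width $\mathrm{dtw}(D)$ is the minimum width of an arboreal decomposition of $D$. *)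

(* Defs.v *)
From mathcomp Require Import all_boot boolp.

Set Implicit Arguments.
Unset Strict Implicit.
Unset Printing Implicit Defensive.

(* Arcs form a relation, so parallel arcs are excluded and antiparallel arcs
   are allowed. *)
Record digraph : Type := Digraph {
  vertex :> finType;
  arc : rel vertex;
  arc_irr : irreflexive arc }.

Definition out_degree (D : digraph) (v : D) : nat := #|[set w : D | arc v w]|.
Definition in_degree (D : digraph) (v : D) : nat := #|[set u : D | arc u v]|.

Definition regular (r : nat) (D : digraph) : Prop :=
  forall v : D, out_degree v = r /\ in_degree v = r.

(* [x :: p] is a directed walk of D - X. *)
Definition walk_avoiding (D : digraph) (X : {set D}) (x : D) (p : seq D) : bool :=
  path (@arc D) x p && all [pred v | v \notin X] (x :: p).

Definition normal (D : digraph) (X Z : {set D}) : Prop :=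
  Z \subset ~: X /\
  ~ exists x p, [/\ walk_avoiding X x p, x \in Z, last x p \in Z
                  & exists2 v, v \in x :: p & v \notin Z].

Definition adjacent (R : digraph) : rel R := [rel x y | arc x y || arc y x].
Arguments adjacent : clear implicits.

(* An orientation of an undirected tree. A [ucycle] of [adjacent] of size 2 is
   a single edge traversed back and forth, hence the bound on the size. *)
Definition directed_tree (R : digraph) : Prop :=
  [/\ 0 < #|R|,
      forall x y : R, ~~ (arc x y && arc y x),
      forall x y : R, connect (adjacent R) x y
    & forall c : seq R, ucycle (adjacent R) c -> size c <= 2].

Definition arborescence (R : digraph) (r0 : R) : Prop :=
  directed_tree R /\ forall t : R, connect (@arc R) r0 t.

(* [guard] is defined on all pairs of nodes, but only its values on arcs of
   the tree are ever used. *)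
Record arboreal_decomposition (D : digraph) : Type := ArborealDecomposition {
  tree : digraph;
  root : tree;
  guard : tree * tree -> {set D};
  bag : tree -> {set D};
  tree_arborescence : arborescence root;
  bag_nonempty : forall t : tree, bag t != set0;
  bag_disjoint : forall s t : tree, s != t -> [disjoint bag s & bag t];
  bag_cover : \bigcup_(t : tree) bag t = [set: D];
  guard_normal : forall s t : tree, arc s t ->
    normal (guard (s, t)) (\bigcup_(u : tree | connect (@arc tree) t u) bag u) }.

Definition incident (R : digraph) (t : R) : pred (R * R) :=
  [pred e | arc e.1 e.2 && ((e.1 == t) || (e.2 == t))].

(* The truncated predecessor is the true one, since bags are nonempty and the
   tree has a root (see [width_succ]). *)
Definition width (D : digraph) (A : arboreal_decomposition D) : nat :=
  (\max_(t : tree A)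
     #|bag t :|: \bigcup_(e : tree A * tree A | incident t e) guard e|).-1.

Definition has_width (D : digraph) (k : nat) : Prop :=
  exists A : arboreal_decomposition D, width A = k.

(* The digraph without vertices has no arboreal decomposition; the value 0 is
   then a dummy. See [dtwP] for the other digraphs. *)
Definition dtw (D : digraph) : nat :=
  match pselect (exists k, `[< has_width D k >]) with
  | left exk => ex_minn exk
  | right _ => 0
  end.

Lemma width_succ (D : digraph) (A : arboreal_decomposition D) :
  (width A).+1 = \max_(t : tree A)
     #|bag t :|: \bigcup_(e : tree A * tree A | incident t e) guard e|.
Proof.
rewrite /width prednK //; apply: (bigmax_sup (root A)) => //.
rewrite card_gt0; apply: contraNneq (bag_nonempty (root A)) => U0.
by rewrite -subset0 -U0 subsetUl.
Qed.

Definition point : digraph := @Digraph unit (fun _ _ => false) (fun _ => erefl).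

Lemma point_arborescence : arborescence (tt : point).
Proof.
split; last by case; exact: connect0.
split=> //; first by rewrite card_unit.
  by move=> [] []; exact: connect0.
by move=> c /andP[_ /card_uniqP <-]; rewrite (leq_trans (max_card _)) ?card_unit.
Qed.

Lemma has_width_ex (D : digraph) : 0 < #|D| -> exists k, has_width D k.
Proof.
move=> D0.
have bag_n0 (t : point) : [set: D] != set0 by rewrite -card_gt0 cardsT.
have bag_dis (s t : point) : s != t -> [disjoint [set: D] & [set: D]].
  by case: s t => [] [].
have bag_cov : \bigcup_(t : point) [set: D] = [set: D].
  by apply/setP=> x; rewrite inE; apply/bigcupP; exists tt; rewrite ?inE.
pose A := @ArborealDecomposition D point tt (fun=> set0) (fun=> setT)
  point_arborescence bag_n0 bag_dis bag_cov (fun s t F => False_ind _ (notF F)).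
by exists (width A), A.
Qed.

Lemma dtwP (D : digraph) : 0 < #|D| ->
  has_width D (dtw D) /\ forall A : arboreal_decomposition D, dtw D <= width A.
Proof.
move=> /has_width_ex[k Dk]; rewrite /dtw; case: pselect => [exk|[]]; last first.
  by exists k; apply/asboolP.
case: ex_minnP => m /asboolP Dm m_min; split=> // A.
by apply: m_min; apply/asboolP; exists A.
Qed.

(* Main.v *)
(** Let [w] be the width plus one and suppose [20 w <= r].  In a regular digraph
    as many arcs enter a set as leave it.  Hence, if [A] and [P] are closed under
    predecessors in [D - X] and [A] is contained in [P], at most [r |X|] arcs
    enter [Q = P \ A].  As at least [|Q| (r - |Q|)] arcs enter [Q], no such [Q]
    has size between [r/4] and [3r/4] when [|X| <= w].  This applies to
    [X]-normal sets, so the union of the bags below a node of the tree has either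
    fewer than [r/4] or more than [3r/4] vertices.  Take a lowest node [t] of the
    second kind, and let [U] be the union of its bag and its incident guards.
    Below [t], every strong component of [D - U] lies below a child of [t], so it
    has fewer than [r/4] vertices.  Adding these components one at a time in
    topological order produces a forbidden [Q]. *)

From mathcomp Require Import all_boot zify.
Require Import Defs.

Set Implicit Arguments.
Unset Strict Implicit.
Unset Printing Implicit Defensive.

(** * Walks avoiding a set, and sets closed under predecessors *)

Section Avoiding.

Variable D : digraph.
Implicit Types (X U Z A P : {set D}).

Definition arc_avoiding X : rel D :=
  [rel x y | [&& arc x y, x \notin X & y \notin X]].

(** What remains of normality once disjointness from [X] is split off as a separate hypothesis. *)
Definition convex X Z : Prop := forall x y z, x \in Z -> z \in Z ->
  connect (arc_avoiding X) x y -> connect (arc_avoiding X) y z -> y \in Z.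

(** Only the tail has to avoid [X]: thus every arc entering [A] from outside starts in [X], which is
    what the arc count uses. *)
Definition pred_closed X A : Prop :=
  forall x y, arc x y -> x \notin X -> y \in A -> x \in A.

(** For convex [Z] disjoint from [X], this set and its union with [Z] are both closed under
    predecessors, and they differ exactly by [Z]. *)
Definition strict_ancestors X Z : {set D} :=
  [set v | [&& v \notin X, v \notin Z
             & [exists z in Z, connect (arc_avoiding X) v z]]].

Lemma walk_avoidingP X x p : x \notin X ->
  path (arc_avoiding X) x p = walk_avoiding X x p.
Proof.
rewrite /walk_avoiding; elim: p x => [|y p IHp] x /= Xx; first by rewrite Xx.
rewrite /arc_avoiding /= Xx /=; case Xy: (y \in X); first by rewrite !andbF.
by rewrite IHp ?Xy //= Xy !andbT -andbA.
Qed.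

Lemma normal_convex X Z : normal X Z -> convex X Z.
Proof.
move=> [ZX nwalk] x y z Zx Zz /connectP[p xp y_p] /connectP[q yq z_q].
case: (boolP (y \in Z)) => // Zy; case: nwalk; exists x, (p ++ q).
have Xx : x \notin X by have := subsetP ZX x Zx; rewrite inE.
split=> //.
- by rewrite -walk_avoidingP // cat_path xp -y_p.
- by rewrite last_cat -y_p -z_q.
- by exists y; rewrite // -cat_cons mem_cat {1}y_p mem_last.
Qed.


Lemma connect1_avoiding X x y : arc x y -> x \notin X -> y \notin X ->
  connect (arc_avoiding X) x y.
Proof. by move=> xy Xx Xy; apply: connect1; apply/and3P. Qed.

Lemma sub_connect_avoiding X U : X \subset U ->
  subrel (connect (arc_avoiding U)) (connect (arc_avoiding X)).
Proof.
move=> XU; apply: connect_sub => x y /and3P[xy Ux Uy].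
by apply: connect1_avoiding; rewrite // (contra (subsetP XU _)).
Qed.

Lemma connect_avoiding_notin X x y :
  connect (arc_avoiding X) x y -> x \notin X -> y \notin X.
Proof.
case/connectP=> p; elim: p x => [|z p IHp] x /= => [_ -> //|].
by case/andP=> /and3P[_ _ Xz] zp y_p _; apply: IHp y_p _.
Qed.

(** Walks avoiding [U] also avoid [X]. This allows one set [U] to replace the various guards at a
    node. *)
Lemma convex_setD X U Z : X \subset U -> convex X Z -> convex U (Z :\: U).
Proof.
move=> XU cZ x y z /setDP[Zx Ux] /setDP[Zz _] xy yz.
rewrite inE (connect_avoiding_notin xy Ux) /=.
by apply: cZ Zx Zz _ _; apply: sub_connect_avoiding XU _ _ _.
Qed.

Lemma strict_ancestors_disjoint X Z : [disjoint strict_ancestors X Z & Z].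
Proof. by rewrite disjoint_subset; apply/subsetP=> v; rewrite !inE => /and3P[]. Qed.

Lemma strict_ancestors_notin X Z : [disjoint strict_ancestors X Z & X].
Proof. by rewrite disjoint_subset; apply/subsetP=> v; rewrite !inE => /and3P[]. Qed.

Lemma pred_closed_ancestors X Z : [disjoint Z & X] ->
  pred_closed X (strict_ancestors X Z :|: Z).
Proof.
move=> dZX x y xy Xx; rewrite !inE Xx /=; case: (boolP (x \in Z)); rewrite ?orbT //.
rewrite !orbF => Zx.
case/orP=> [/and3P[Xy Zy /existsP[z /andP[Zz yz]]]|Zy]; apply/existsP.
  by exists z; rewrite Zz (connect_trans (connect1_avoiding _ _ _) yz).
by exists y; rewrite Zy connect1_avoiding // (disjointFr dZX Zy).
Qed.

Lemma pred_closed_strict_ancestors X Z : convex X Z ->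
  pred_closed X (strict_ancestors X Z).
Proof.
move=> cZ x y xy Xx; rewrite !inE Xx /=.
case/and3P=> [Xy Zy /existsP[z /andP[Zz yz]]].
have e := connect1_avoiding xy Xx Xy.
apply/andP; split; first by apply: contra Zy => Zx; apply: cZ Zx Zz e yz.
by apply/existsP; exists z; rewrite Zz (connect_trans e yz).
Qed.

Lemma pred_closed_connect X A x y : pred_closed X A ->
  connect (arc_avoiding X) x y -> y \in A -> x \in A.
Proof.
move=> cA /connectP[p]; elim: p x => [|z p IHp] x /= => [_ -> //|].
by case/andP=> /and3P[xz Xx _] zp y_p Ay; apply: cA xz Xx (IHp _ zp y_p Ay).
Qed.

(* For a vertex of [P \ A] with the fewest ancestors, the ancestors outside [A]
   all lie in its strong component. *)
Lemma pred_closed_extend X A P : pred_closed X A -> pred_closed X P ->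
  [disjoint P & X] -> A \proper P ->
  exists2 v, v \in P :\: A & exists2 C : {set D}, v \in C &
    pred_closed X (A :|: C) /\ (forall u, u \in C ->
      connect (arc_avoiding X) u v /\ connect (arc_avoiding X) v u).
Proof.
move=> cA cP dPX /properP[_ [v0 Pv0 Av0]].
pose anc v := [set u | connect (arc_avoiding X) u v].
have PAv0 : v0 \in P :\: A by rewrite inE Av0.
case: (arg_minnP (fun v => #|anc v|) PAv0) => v PAv vmin; exists v => //.
have [Pv Av] := setDP PAv.
exists (anc v :\: A); first by rewrite !inE Av connect0.
split=> [x y xy Xx|u].
  rewrite !inE; case: (boolP (x \in A)) => //= Ax /orP[Ay|/andP[Ay yv]].
    by rewrite (cA _ _ xy Xx Ay) in Ax.
  apply: connect_trans (connect1_avoiding xy Xx _) (yv).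
  by rewrite (disjointFr dPX (pred_closed_connect cP yv Pv)).
rewrite !inE => /andP[Au uv]; split=> //.
have sub : anc u \subset anc v.
  by apply/subsetP=> x; rewrite !inE => /connect_trans; apply.
have PAu : u \in P :\: A by rewrite inE Au (pred_closed_connect cP uv Pv).
have /eqP eqA : anc u == anc v by rewrite eqEcard sub (vmin _ PAu).
by have : v \in anc u by [rewrite eqA inE connect0]; rewrite inE.
Qed.

End Avoiding.

(** * Arc counts in a regular digraph *)

Section Counting.

Variable D : digraph.
Implicit Types (X U Z A P S T : {set D}).

Definition narcs S T : nat := \sum_(x in S) \sum_(y in T) arc x y.

Lemma narcsIDl X S T : narcs S T = narcs (S :&: X) T + narcs (S :\: X) T.
Proof. exact: big_setID. Qed.

Lemma narcsIDr X S T : narcs S T = narcs S (T :&: X) + narcs S (T :\: X).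
Proof.
by rewrite /narcs -big_split; apply: eq_bigr => x _; apply: big_setID.
Qed.

Lemma narcsSl S1 S2 T : S1 \subset S2 -> narcs S1 T <= narcs S2 T.
Proof. by move=> S12; rewrite (narcsIDl S1 S2) (setIidPr S12) leq_addr. Qed.

Lemma narcsSr S T1 T2 : T1 \subset T2 -> narcs S T1 <= narcs S T2.
Proof. by move=> T12; rewrite (narcsIDr T1 S T2) (setIidPr T12) leq_addr. Qed.

Lemma narcs_le_card S T : narcs S T <= #|S| * #|T|.
Proof.
rewrite /narcs -sum_nat_const leq_sum // => x _; rewrite -sum1_card leq_sum //.
by move=> y _; case: arc.
Qed.

Variable r : nat.
Hypothesis D_regular : regular r D.

Lemma narcs_setTr S : narcs S setT = #|S| * r.
Proof.
rewrite /narcs -sum_nat_const; apply: eq_bigr => x _.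
rewrite -(D_regular x).1 /out_degree -sum1dep_card [RHS]big_mkcond /=.
by apply: eq_big => [y|y _]; rewrite ?inE //; case: arc.
Qed.

Lemma narcs_setTl S : narcs setT S = #|S| * r.
Proof.
rewrite /narcs exchange_big -sum_nat_const; apply: eq_bigr => x _.
rewrite -(D_regular x).2 /in_degree -sum1dep_card [RHS]big_mkcond /=.
by apply: eq_big => [y|y _]; rewrite ?inE //; case: arc.
Qed.

Lemma narcs_balanced S : narcs S (~: S) = narcs (~: S) S.
Proof.
have := narcs_setTr S; rewrite -narcs_setTl (narcsIDr S) (narcsIDl S setT).
by rewrite !setTI !setTD => /addnI.
Qed.

(** Of the [#|S| * r] arcs with head in [S], at most [#|S| * #|S|] have their tail in [S]. *)
Lemma narcs_in_ge S : #|S| * (r - #|S|) <= narcs (~: S) S.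
Proof.
have := narcs_setTl S; rewrite (narcsIDl S) setTI setTD mulnBr.
by have := narcs_le_card S S; lia.
Qed.

Lemma narcs_pred_closed X P T : pred_closed X P -> T \subset P ->
  narcs (~: P) T <= narcs X T.
Proof.
move=> cP TP; rewrite (narcsIDl X) [narcs (_ :\: _) _]big1.
  by rewrite addn0 narcsSl ?subsetIr.
move=> x /setDP[]; rewrite inE => Px Xx; apply: big1 => y /(subsetP TP) Py.
by case: (boolP (arc x y)) => // xy; rewrite (cP _ _ xy Xx Py) in Px.
Qed.

(** An arc entering [P :\: A] comes from outside [P], hence from [X], or leaves [A]. The latter are
    as many as the arcs entering [A], which also start in [X]. The two families of arcs from [X]
    have disjoint sets of heads, [P :\: A] and [A]. *)
Lemma pred_closed_gap X A P : A \subset P ->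
  pred_closed X A -> pred_closed X P ->
  #|P :\: A| * (r - #|P :\: A|) <= #|X| * r.
Proof.
move=> AP cA cP; apply: leq_trans (narcs_in_ge _) _.
rewrite (narcsIDl A).
have -> : ~: (P :\: A) :&: A = A.
  by apply/setIidPr; rewrite -disjoints_subset disjoint_sym disjoints_subset setDE subsetIr.
have -> : ~: (P :\: A) :\: A = ~: P.
  by rewrite [LHS]setDE -setCU setUC setDE setUIr setUCr setIT (setUidPr AP).
have hP : narcs (~: P) (P :\: A) <= narcs X (P :\: A).
  by apply: narcs_pred_closed; rewrite ?subsetDl.
have hA : narcs A (P :\: A) <= narcs X A.
  apply: leq_trans (narcs_pred_closed cA (subxx _)); rewrite -narcs_balanced.
  by apply: narcsSr; rewrite setDE subsetIr.
apply: leq_trans (leq_add hA hP) _.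
by rewrite -{1}(setIidPr AP) -narcsIDr -narcs_setTr narcsSr ?subsetT.
Qed.

Lemma convex_gap X Z : convex X Z -> [disjoint Z & X] ->
  #|Z| * (r - #|Z|) <= #|X| * r.
Proof.
move=> cZ dZX; have := pred_closed_gap (subsetUl _ Z)
  (pred_closed_strict_ancestors cZ) (pred_closed_ancestors dZX).
rewrite setDUl setDv set0U setDE; congr (_ * (r - _) <= _);
  by rewrite (setIidPl _) // -disjoints_subset disjoint_sym strict_ancestors_disjoint.
Qed.

(** For [n] between [r/4] and [3r/4], the product [n * (r - n)] is at least [3r^2/16], which exceeds
    [r^2/20]. *)
Lemma quarter_gap m n : 0 < r -> 20 * m <= r -> n * (r - n) <= m * r ->
  4 * n < r \/ 3 * r < 4 * n.
Proof.
move=> r0 mr nr; case: (ltnP (4 * n) r) => [|rn]; first by left.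
case: (ltnP (3 * r) (4 * n)) => [|nr3]; first by right.
have : 20 * m * r <= r * r by rewrite leq_mul2r mr orbT.
have : 0 < r * r by rewrite muln_gt0 r0.
by move: nr rn nr3; rewrite mulnBr; nia.
Qed.

Lemma convex_small_cover U Z : 0 < r -> 20 * #|U| <= r -> convex U Z ->
  [disjoint Z & U] ->
  (forall v, v \in Z -> exists Y : {set D}, [/\ v \in Y, convex U Y & 4 * #|Y| < r]) ->
  4 * #|Z| < r.
Proof.
move=> r0 Ur cZ dZU coverZ; case: (ltnP (4 * #|Z|) r) => // rZ.
set A0 := strict_ancestors U Z; pose P0 := A0 :|: Z.
have cA0 : pred_closed U A0 by apply: pred_closed_strict_ancestors.
have cP0 : pred_closed U P0 by apply: pred_closed_ancestors.
have dP0 : [disjoint P0 & U].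
  by rewrite disjoints_subset subUset -!disjoints_subset dZU strict_ancestors_notin.
(* If [Z] were large, the growing set would never exhaust [P0], so it would outgrow [D]. *)
suff grow n : exists A : {set D}, [/\ n <= #|A|, pred_closed U A, A0 \subset A,
    A \subset P0 & 4 * #|A :\: A0| < r].
  by have [A [DA _ _ _ _]] := grow #|D|.+1; rewrite ltnNge max_card in DA.
elim: n => [|n [A [nA cA A0A AP0 sA]]].
  by exists A0; split; rewrite ?subsetUl // setDv cards0 muln0.
have pA : A \proper P0.
  rewrite properE AP0; apply: contraL sA => P0A; rewrite -leqNgt.
  apply: leq_trans rZ _; rewrite leq_mul2l subset_leq_card //.
  apply/subsetP=> z Zz; rewrite inE (disjointFl (strict_ancestors_disjoint U Z) Zz).
  by rewrite (subsetP P0A) // inE Zz orbT.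
have [v /setDP[P0v Av] [C Cv [cAC strongC]]] := pred_closed_extend cA cP0 dP0 pA.
have Zv : v \in Z.
  by case/setUP: P0v => // /(subsetP A0A); rewrite (negPf Av).
have [Y [Yv cY sY]] := coverZ v Zv.
have CY : C \subset Y.
  (* A convex set contains the strong component of each of its vertices. *)
  by apply/subsetP=> u /strongC[uv vu]; apply: (cY v u v).
have CP0 : C \subset P0.
  by apply/subsetP=> u /strongC[uv _]; apply: pred_closed_connect cP0 uv P0v.
have A0AC : A0 \subset A :|: C by rewrite (subset_trans A0A) ?subsetUl.
have sAC : #|(A :|: C) :\: A0| <= #|A :\: A0| + #|Y|.
  rewrite setDUl; apply: leq_trans (leq_card_setU _ _) _.
  by rewrite leq_add2l subset_leq_card // (subset_trans (subsetDl _ _)).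
exists (A :|: C); split=> //.
- apply: leq_ltn_trans nA _; apply: proper_card; apply/properP.
  by rewrite subsetUl; split=> //; exists v; rewrite // inE Cv orbT.
- by rewrite subUset AP0.
(* Two summands below [r/4] give less than [r/2], so the gap brings the size back below [r/4]. *)
- by case: (quarter_gap r0 Ur (pred_closed_gap A0AC cA0 cAC)) => //; lia.
Qed.

End Counting.

(** * Arborescences and arboreal decompositions *)

Lemma directed_tree_acyclic (R : digraph) (s t : R) :
  directed_tree R -> arc s t -> ~~ connect (@arc R) t s.
Proof.
case=> _ anti _ no_cycle st; apply/negP => /connectP[p0 tp0 s_p0].
case/shortenP: tp0 s_p0 => p tp Up _ s_p.
have tp' : path (adjacent R) t p
  by apply: sub_path tp => x y xy; rewrite /adjacent /= xy.
have /no_cycle : ucycle (adjacent R) (t :: p).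
  by rewrite /ucycle Up andbT /= rcons_path tp' -s_p /adjacent /= st.
(* The cycle has size at most 2: size 1 is a loop, size 2 an antiparallel pair. *)
case: p tp {tp' Up} s_p => [_ /= ts|x [|//] /= /andP[tx _] sx _].
  by rewrite ts arc_irr in st.
by have := anti s t; rewrite sx tx -sx st.
Qed.

Section Decomposition.

Variables (D : digraph) (A : arboreal_decomposition D).

Definition below (t : tree A) : {set D} :=
  \bigcup_(u : tree A | connect (@arc (tree A)) t u) bag u.

Definition zone (t : tree A) : {set D} :=
  bag t :|: \bigcup_(e : tree A * tree A | incident t e) guard e.

Lemma below_root : below (root A) = [set: D].
Proof.
rewrite -(bag_cover A) /below; apply: eq_bigl => u.
by case: (tree_arborescence A) => _ ->.
Qed.

Lemma guard_zone (s t x : tree A) : arc s t -> (x == s) || (x == t) ->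
  guard (s, t) \subset zone x.
Proof.
move=> st xst; apply: subsetU; apply/orP; right.
by apply: (bigcup_sup (s, t)); rewrite /incident /= st !(eq_sym _ x).
Qed.

Lemma below_guard_disjoint (s t : tree A) : arc s t ->
  [disjoint below t & guard (s, t)].
Proof. by move=> /guard_normal[]; rewrite disjoints_subset. Qed.

Lemma below_convex (s t : tree A) : arc s t -> convex (guard (s, t)) (below t).
Proof. by move=> /guard_normal /normal_convex. Qed.

Lemma below_children (t : tree A) (v : D) : v \in below t :\: zone t ->
  exists2 c, arc t c & v \in below c.
Proof.
case/setDP=> /bigcupP[u tu uv] zv; case/connectP: tu => [[|c p] /= tp u_p].
  by rewrite !inE -u_p uv in zv.
case/andP: tp => tc cp; exists c => //.
by apply/bigcupP; exists u => //; apply/connectP; exists p.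
Qed.

Lemma parent_ex (t : tree A) : t != root A -> exists s, arc s t.
Proof.
move=> t_root; have [_ /(_ t) /connectP[p]] := tree_arborescence A.
case/lastP: p => [_ /= t_eq|p s]; first by rewrite t_eq eqxx in t_root.
by rewrite rcons_path last_rcons => /andP[_ ps] ->; exists (last (root A) p).
Qed.

End Decomposition.

(** * The lower bound on directed tree-width *)

Theorem theorem1p14 (r : nat) (D : digraph) (D_nonempty : 0 < #|D|)
  (D_regular : regular r D) : r %/ 20 <= dtw D.
Proof.
have [[A <-] _] := dtwP D_nonempty; rewrite leqNgt; apply/negP => wr.
(* The strict inequality [wr] absorbs the [-1] in the width. *)
have zone_le (t : tree A) : 20 * #|zone t| <= r.
  have : #|zone t| <= (width A).+1 by rewrite width_succ; apply: leq_bigmax.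
  by move: wr; lia.
have r0 : 0 < r by lia.
have card_D : r <= #|D|.
  by have /card_gt0P[v _] := D_nonempty; rewrite -(D_regular v).1 max_card.
pose big := [pred t : tree A | r <= 4 * #|below t|].
have big_root : big (root A) by rewrite /= below_root cardsT; lia.
(* A big node with fewest descendants: by acyclicity each child has strictly fewer, hence is not
   big. *)
case: (arg_minnP (fun t => #|[set u | connect (@arc (tree A)) t u]|) big_root).
move=> t big_t t_min; set U := zone t.
have small_child c : arc t c -> 4 * #|below c| < r.
  move=> tc; rewrite ltnNge; apply/negP => /t_min; rewrite leqNgt => /negP; apply.
  apply: proper_card; apply/properP; split.
    by apply/subsetP=> u; rewrite !inE => /(connect_trans (connect1 tc)).
  exists t; rewrite !inE ?connect0 //.
  by apply: directed_tree_acyclic tc; case: (tree_arborescence A).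
have [cB large] : convex U (below t :\: U) /\ 3 * r < 4 * #|below t|.
  (* The root has no entering guard, but there the set below is all of [D], with at least [r]
     vertices. Elsewhere the gap applies to the guard of the entering arc. *)
  have [->|/parent_ex[s st]] := eqVneq t (root A).
    rewrite below_root cardsT; split; last lia.
    by apply: (@convex_setD _ set0); rewrite ?sub0set // => *; rewrite inE.
  have gU : guard (s, t) \subset U by rewrite guard_zone // eqxx orbT.
  split; first by apply: convex_setD gU (below_convex st).
  have gr : 20 * #|guard (s, t)| <= r.
    by apply: leq_trans (zone_le t); rewrite leq_mul2l subset_leq_card.
  have := convex_gap D_regular (below_convex st) (below_guard_disjoint st).
  by case/(quarter_gap r0 gr) => //; move: big_t => /=; lia.
have /(convex_small_cover D_regular r0 (zone_le t) cB) small :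
    [disjoint below t :\: U & U].
  by rewrite disjoints_subset setDE subsetIr.
have /small {}small v : v \in below t :\: U ->
    exists Y : {set D}, [/\ v \in Y, convex U Y & 4 * #|Y| < r].
  move=> Bv; have [c tc cv] := below_children Bv; exists (below c :\: U).
  split; first by rewrite inE cv; case/setDP: Bv => _ ->.
    apply: convex_setD (below_convex tc).
    by rewrite guard_zone // eqxx.
  apply: leq_ltn_trans (small_child c tc).
  by rewrite leq_mul2l subset_leq_card ?subsetDl.
(* Now [below t] has fewer than [r/20 + r/4] vertices up to equality in the first term, against more
   than [3r/4] by [large]. *)
have := zone_le t; rewrite -/U -(cardsID U (below t)) in large *.
have : #|below t :&: U| <= #|U| by rewrite subset_leq_card ?subsetIr.
by move: large; lia.
Qed.
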